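(* For any time step $t\in\mathbb N$, with past context-control pairs $q_0,\dots,q_{t-1}$, current context $z_t$, and $m_{t,\alpha,\beta}=\alpha C_{t-1}^++\beta C_{t-1}^-$ as in the context, the optimization problem $$\underset{u\in\mathcal U}{\text{minimize}}\quad m_{t,\alpha,\beta}(z_t,u)$$ can be solved via (i) the finite minimum of at most $t^2$ convex quadratic programs for $\alpha>0\ge\beta$; (ii) the finite minimum of at most $t$ convex quadratic programs for $\alpha>\beta\ge0$; (iii) the finite minimum of at most $t$ linear programs for $\alpha=\beta$; (iv) a single concave quadratic minimization program for $\beta>\alpha\ge0$; and (v) the finite minimum of at most $t$ concave quadratic minimization programs for $\beta>0\ge\alpha$.
   Context: $\mathcal U\subset\mathbb R^{n_{\mathcal U}}$ is convex and compact, $\mathcal Z\subset\mathbb R^{n_{\mathcal Z}}$ is compact, $\alpha,\beta\in\mathbb R$, and $C:\mathcal Z\times\mathcal U\to\mathbb R$ is continuously differentiable with $\|\nabla C(y)-\nabla C(x)\|\le L_C\|y-x\|$ for all $x,y\in\mathcal Z\times\mathcal U$, where $L_C>0$ is known and $\|\cdot\|$ is the Euclidean norm. For points $q_i=(z_i,u_i)\in\mathcal Z\times\mathcal U$, $i=0,\dots,t-1$, at which $C(q_i)$ and $\nabla C(q_i)$ are known, set $\ell(s;C,q)=C(q)+\nabla C(q)\cdot(s-q)$ and $$C_{t-1}^+(s)=\min_{0\le i\le t-1}\Big(\ell(s;C,q_i)+\tfrac{L_C}{2}\|s-q_i\|^2\Big),\quad C_{t-1}^-(s)=\max_{0\le i\le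 t-1}\Big(\ell(s;C,q_i)-\tfrac{L_C}{2}\|s-q_i\|^2\Big),$$ and $m_{t,\alpha,\beta}(z,u)=\alpha C_{t-1}^+(z,u)+\beta C_{t-1}^-(z,u)$. Terminology. A convex quadratic (resp. linear, resp. concave quadratic minimization) program is the problem of minimizing a convex quadratic (resp. affine, resp. concave quadratic) function of $u\in\mathcal U$ and possibly an auxiliary real (epigraph) variable, subject to finitely many affine inequalities in these variables. ''Solved via the finite minimum of at most $K$ programs'' means that an optimal solution is computed by solving at most $K$ such programs separately and taking one with the smallest optimal value.
   Formalization: In (iv), when α>0 and t≥2, the single concave quadratic program may use up to t auxiliary real variables instead of one; one auxiliary variable is not enough in general (it already fails for t=3 with two control dimensions). For α=0 or t=1 one variable is kept. *)

(* Defs.v *)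
From HB Require Import structures.
From mathcomp Require Import all_boot all_order all_algebra.
From mathcomp Require Import all_classical all_reals all_analysis.

Set Implicit Arguments.
Unset Strict Implicit.
Unset Printing Implicit Defensive.

Import Order.TTheory GRing.Theory Num.Theory.
Import numFieldNormedType.Exports.

Local Open Scope classical_set_scope.
Local Open Scope ring_scope.

Definition dot (R : realType) (n : nat) (x y : 'rV[R]_n) : R :=
  \sum_(i < n) x 0 i * y 0 i.

(* The library norm on 'rV_n is the sup norm. *)
Definition enorm (R : realType) (n : nat) (x : 'rV[R]_n) : R :=
  Num.sqrt (dot x x).

Definition grad (R : realType) (n : nat) (C : 'rV[R]_n -> R) (x : 'rV[R]_n) :
    'rV[R]_n :=
  \row_(i < n) 'D_(delta_mx 0 i) C x.

(* A point (z, u) is the concatenation row_mx z u. *)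
Definition setZU (R : realType) (nZ nU : nat)
    (Z : set 'rV[R]_nZ) (U : set 'rV[R]_nU) : set 'rV[R]_(nZ + nU) :=
  [set s | Z (lsubmx s) /\ U (rsubmx s)].

(* A has no reason to be open, so C is asked to be C^1 on some open set
   containing A; this gives a meaning to the gradient of C on A. *)
Definition continuously_differentiable_on (R : realType) (n : nat)
    (A : set 'rV[R]_n) (C : 'rV[R]_n -> R) : Prop :=
  exists O : set 'rV[R]_n,
    [/\ open O, A `<=` O, forall x, O x -> differentiable C x &
        forall x, O x -> {for x, continuous (grad C)}].

Definition grad_lipschitz_on (R : realType) (n : nat) (A : set 'rV[R]_n)
    (L : R) (C : 'rV[R]_n -> R) : Prop :=
  forall x y, A x -> A y -> enorm (grad C y - grad C x) <= L * enorm (y - x).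

Record standing (R : realType) (nZ nU : nat) (L : R) (Z : set 'rV[R]_nZ)
    (U : set 'rV[R]_nU) (C : 'rV[R]_(nZ + nU) -> R) : Prop := Standing {
  standing_convexU : convex_set U;
  standing_compactU : compact U;
  standing_compactZ : compact Z;
  standing_C1 : continuously_differentiable_on (setZU Z U) C;
  standing_lip : grad_lipschitz_on (setZU Z U) L C }.

Definition lin_approx (R : realType) (n : nat) (C : 'rV[R]_n -> R)
    (q s : 'rV[R]_n) : R :=
  C q + dot (grad C q) (s - q).

(* Ordinal t0 : 'I_t is the index 0; used as the default value of the iterated
   min (resp. max), it does not change its value. *)
Definition Cplus (R : realType) (n t : nat) (t0 : (0 < t)%N) (L : R)
    (C : 'rV[R]_n -> R) (q : 'I_t -> 'rV[R]_n) (s : 'rV[R]_n) : R :=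
  let f i := lin_approx C (q i) s + L / 2 * enorm (s - q i) ^+ 2 in
  \big[Num.min/f (Ordinal t0)]_(i < t) f i.

Definition Cminus (R : realType) (n t : nat) (t0 : (0 < t)%N) (L : R)
    (C : 'rV[R]_n -> R) (q : 'I_t -> 'rV[R]_n) (s : 'rV[R]_n) : R :=
  let f i := lin_approx C (q i) s - L / 2 * enorm (s - q i) ^+ 2 in
  \big[Num.max/f (Ordinal t0)]_(i < t) f i.

Definition m_acq (R : realType) (n t : nat) (t0 : (0 < t)%N) (L alpha beta : R)
    (C : 'rV[R]_n -> R) (q : 'I_t -> 'rV[R]_n) (s : 'rV[R]_n) : R :=
  alpha * Cplus t0 L C q s + beta * Cminus t0 L C q s.

Definition minimizer (R : realType) (T : Type) (A : set T) (f : T -> R) (x : T) :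
    Prop :=
  A x /\ forall y, A y -> f x <= f y.

(* The variable is x = row_mx u w, with u the control and w the auxiliary
   variables; the problem is to minimize
     x Q x^T + x c + d   subject to   u \in U  and  x A <= b (entrywise).
   The constraint set U is not part of the record.  One auxiliary variable
   encodes a maximum of affine functions (epigraph).  Several of them allow a
   concave quadratic program to encode a minimum of affine functions a_i(u)
   added to - kappa |u|^2 with kappa > 0: minimize
     - kappa |u|^2 + \sum_i w_i a_i(u) - N (\sum_i w_i^2 - 1)
   over w in the simplex; this is jointly concave for N large, so that the
   minimum in w is reached at a vertex, where the last term vanishes. *)
Record program (R : realType) (n : nat) := Program {
  naux : nat;
  pquad : 'M[R]_(n + naux);
  plin : 'cV[R]_(n + naux);
  pcst : R;
  ncons : nat;
  pA : 'M[R]_(n + naux, ncons);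
  pb : 'rV[R]_ncons }.

Definition objective (R : realType) (n : nat) (P : program R n)
    (x : 'rV[R]_(n + naux P)) : R :=
  (x *m pquad P *m x^T) 0 0 + (x *m plin P) 0 0 + pcst P.
Arguments objective {R n} P x.

Definition feasible (R : realType) (n : nat) (U : set 'rV[R]_n)
    (P : program R n) : set 'rV[R]_(n + naux P) :=
  [set x | U (lsubmx x) /\ forall i, (x *m pA P) 0 i <= pb P 0 i].
Arguments feasible {R n} U P.

Definition is_convex_quadratic (R : realType) (n : nat) (P : program R n) : Prop :=
  convex_function setT (objective P).

Definition is_concave_quadratic (R : realType) (n : nat) (P : program R n) : Prop :=
  convex_function setT (fun x => - objective P x).

Definition is_linear_program (R : realType) (n : nat) (P : program R n) : Prop :=
  pquad P = 0.

(* Minimizing f over U through the k programs P i: each of them has an optimal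
   solution and, however optimal solutions are chosen, the control component of
   one with the smallest optimal value minimizes f over U. *)
Definition solved_via (R : realType) (n k : nat) (U : set 'rV[R]_n)
    (f : 'rV[R]_n -> R) (P : 'I_k -> program R n) : Prop :=
  (forall i, exists x, minimizer (feasible U (P i)) (objective (P i)) x) /\
  forall x : (forall i, 'rV[R]_(n + naux (P i))),
    (forall i, minimizer (feasible U (P i)) (objective (P i)) (x i)) ->
    forall j, (forall i, objective (P j) (x j) <= objective (P i) (x i)) ->
    minimizer U f (lsubmx (x j)).

(* The programs are chosen knowing only L, alpha, beta, the context zt, the
   points q i and the values c i, g i of C and grad C there; they then have to
   work for every Z, U and C compatible with these data.  Were they chosen after
   U and C, the single program with the constraint u = u*, for u* a solution of
   the original problem, would always do. *)
Definition solvable_by (R : realType) (nZ nU t : nat) (t0 : (0 < t)%N)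
    (L alpha beta : R) (zt : 'rV[R]_nZ) (q : 'I_t -> 'rV[R]_(nZ + nU))
    (c : 'I_t -> R) (g : 'I_t -> 'rV[R]_(nZ + nU))
    (kind : program R nU -> Prop) (maxaux K : nat) : Prop :=
  exists (k : nat) (P : 'I_k -> program R nU),
    [/\ (0 < k <= K)%N,
        forall i, kind (P i),
        forall i, (naux (P i) <= maxaux)%N &
        forall (Z : set 'rV[R]_nZ) (U : set 'rV[R]_nU)
               (C : 'rV[R]_(nZ + nU) -> R),
          standing L Z U C ->
          Z zt ->
          (forall i, setZU Z U (q i)) ->
          (forall i, C (q i) = c i) ->
          (forall i, grad C (q i) = g i) ->
          solved_via U (fun u => m_acq t0 L alpha beta C q (row_mx zt u)) P].

(* Main.v *)
Require Import Defs.
From HB Require Import structures.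
From mathcomp Require Import all_boot all_order all_algebra.
From mathcomp Require Import ring lra.
From mathcomp Require Import all_classical all_reals all_analysis.

Import Order.TTheory GRing.Theory Num.Theory.
Import numFieldNormedType.Exports.

Local Open Scope classical_set_scope.
Local Open Scope ring_scope.

(** Along [s = (zt, u)] each quadratic model splits as [+- L/2 |u|^2] plus an
    affine function of [u], so the objective is [kappa |u|^2] with
    [kappa = (alpha - beta) L/2], plus [alpha] times a minimum and [beta] times
    a maximum of affine functions.  After multiplication by its coefficient,
    each of these is a maximum or a minimum according to the sign.  A maximum is
    handled by an epigraph variable; a minimum is either pulled out of the
    problem, one program per piece, or, when [kappa < 0], encoded by simplex
    weights. *)

(** * Quadratic objectives along segments *)

(** Reduces convexity and concavity to the sign of the quadratic form. The matrix [pquad] may be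
    asymmetric, so both cross terms are kept. *)
Lemma objective_conv {R : realType} {n : nat} (P : program R n)
    (a b : R) (x y : 'rV[R]_(n + naux P)) : a + b = 1 ->
  @objective _ _ P (a *: x + b *: y) =
    a * @objective _ _ P x + b * @objective _ _ P y
    - a * b * ((x - y) *m pquad P *m (x - y)^T) 0 0.
Proof.
move=> ab.
have trD (u v : 'rV[R]_(n + naux P)) : (u + v)^T = u^T + v^T by exact: linearD.
have trZ k (u : 'rV[R]_(n + naux P)) : (k *: u)^T = k *: u^T by exact: linearZ.
rewrite /objective -[- y]scaleN1r !(trD, trZ).
rewrite !(mulmxDl, mulmxDr) -!(scalemxAl, scalemxAr).
set qxx := x *m _ *m _; set qxy := x *m _ *m _.
set qyx := y *m _ *m _; set qyy := y *m _ *m _.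
have -> : b = 1 - a by rewrite -ab addrC addKr.
rewrite !mxE; ring.
Qed.

Lemma convex_quadraticP {R : realType} {n : nat} (P : program R n) :
  (forall x : 'rV_(n + naux P), 0 <= (x *m pquad P *m x^T) 0 0) ->
  is_convex_quadratic P.
Proof.
move=> Q0 p x y _ _; rewrite convRE.
rewrite (@objective_conv _ _ P p%:num (1 - p%:num) x y) ?subrKC// gerBl.
by rewrite mulr_ge0// mulr_ge0// onem_ge0.
Qed.

Lemma concave_quadraticP {R : realType} {n : nat} (P : program R n) :
  (forall x : 'rV_(n + naux P), (x *m pquad P *m x^T) 0 0 <= 0) ->
  is_concave_quadratic P.
Proof.
move=> Q0 p x y _ _; rewrite convRE.
rewrite (@objective_conv _ _ P p%:num (1 - p%:num) x y) ?subrKC//.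
rewrite opprB opprD !mulrN gerDr.
by rewrite mulr_ge0_le0// mulr_ge0// onem_ge0.
Qed.

(** * Affine functions and the Euclidean product *)

(** Slope and constant term; [R^o] makes the pair a left module, so that affine pieces can be scaled
    and added as data. *)
Definition affine (R : realType) (n : nat) : Type := ('cV[R]_n * R^o)%type.

HB.instance Definition _ (R : realType) (n : nat) :=
  GRing.Lmodule.on (affine R n).

Definition aff {R : realType} {n : nat} (a : affine R n) (u : 'rV[R]_n) : R :=
  (u *m a.1) 0 0 + a.2.

Lemma affD {R : realType} {n : nat} (a b : affine R n) u :
  aff (a + b) u = aff a u + aff b u.
Proof. by rewrite /aff mulmxDr mxE addrACA. Qed.

Lemma affZ {R : realType} {n : nat} (k : R) (a : affine R n) u :
  aff (k *: a) u = k * aff a u.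
Proof. by rewrite /aff -scalemxAr mxE mulrDr. Qed.

Lemma aff0 {R : realType} {n : nat} (u : 'rV[R]_n) : aff 0 u = 0.
Proof. by rewrite /aff mulmx0 mxE addr0. Qed.

Lemma affB {R : realType} {n : nat} (a b : affine R n) u :
  aff (a - b) u = aff a u - aff b u.
Proof. by rewrite affD -scaleN1r affZ mulN1r. Qed.

Lemma dot_mulmx {R : realType} {n : nat} (x y : 'rV[R]_n) :
  dot x y = (x *m y^T) 0 0.
Proof. by rewrite mxE; apply: eq_bigr => i _; rewrite mxE. Qed.

Lemma dotxx_ge0 {R : realType} {n : nat} (x : 'rV[R]_n) : 0 <= dot x x.
Proof. by apply: sumr_ge0 => i _; exact: sqr_ge0. Qed.

Lemma enorm_sqr {R : realType} {n : nat} (x : 'rV[R]_n) :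
  enorm x ^+ 2 = dot x x.
Proof. by rewrite sqr_sqrtr// dotxx_ge0. Qed.

(** * The program with simplex weights and an epigraph variable *)

Section minmax_program.
Context {R : realType} {n r : nat} {T : finType}.
Variables (kappa N : R) (a : affine R n) (d : 'I_r -> affine R n)
  (b : T -> affine R n).

(* Minimize kappa |u|^2 + a(u) + \sum_i w_i d_i(u) + N \sum_i w_i (1 - w_i) + v
   subject to b_t(u) <= v, 0 <= w_i and \sum_i w_i <= 1, in the variable
   row_mx u (row_mx w v).  For N >= 0 its partial minimum over (w, v) is
   kappa |u|^2 + a(u) + min(0, min_i d_i(u)) + max_t b_t(u): the N-term is
   nonnegative and vanishes at the vertices of the simplex.  Taking
   d_i = a_i - a makes the minimum range over a and the a_i, with one weight
   fewer than there are pieces. *)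
Definition minmax_program : program R n :=
  @Program R n (r + 1)
    (block_mx kappa%:M (row_mx (\matrix_(i, j) (d j).1 i 0) 0)
              0 (block_mx (- N)%:M 0 0 0))
    (col_mx a.1 (col_mx (\col_i ((d i).2 + N)) 1))
    a.2
    (#|T| + (r + 1))
    (block_mx (\matrix_(i, j) (b (enum_val j)).1 i 0) 0
              (col_mx 0 (const_mx (-1)))
              (block_mx (- 1)%:M (const_mx 1) 0 0))
    (row_mx (\row_j - (b (enum_val j)).2) (row_mx 0 1)).

(** The matrix is block triangular, so the coupling of [u] and [w] occurs once, without a factor
    2. *)
Lemma minmax_program_quad (u : 'rV_n) (w : 'rV_r) (v : 'rV_1) :
  (row_mx u (row_mx w v) *m pquad minmax_program *m
     (row_mx u (row_mx w v))^T) 0 0 =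
  kappa * dot u u + \sum_i w 0 i * (u *m (d i).1) 0 0 - N * dot w w.
Proof.
rewrite /= !tr_row_mx !mul_row_block !mul_row_col !mulmx0 !addr0.
rewrite mul_mx_row mulmx0 add_row_mx addr0 mul_row_col mul0mx addr0 mulmxDl.
rewrite !mul_mx_scalar -!scalemxAl.
rewrite mxE [in X in X + _]mxE -dot_mulmx mxE [X in _ + (_ + X)]mxE -dot_mulmx.
rewrite -addrA mulNr; congr (_ + (_ + _)).
rewrite mxE; apply: eq_bigr => i _; rewrite [X in _ * X]mxE mulrC; congr (_ * _).
by rewrite !mxE; apply: eq_bigr => j _; rewrite !mxE.
Qed.

Lemma minmax_program_objective (u : 'rV_n) (w : 'rV_r) (v : 'rV_1) :
  @objective _ _ minmax_program (row_mx u (row_mx w v)) =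
  kappa * dot u u + aff a u + \sum_i w 0 i * aff (d i) u
  + N * (\sum_i w 0 i * (1 - w 0 i)) + v 0 0.
Proof.
rewrite /objective minmax_program_quad /= !mul_row_col mulmx1.
rewrite mxE [X in _ + (_ + X)]mxE [X in _ + (_ + (X + _))]mxE.
have -> : \sum_i w 0 i * (\col_i ((d i).2 + N)) i 0 =
    \sum_i w 0 i * (d i).2 + N * \sum_i w 0 i.
  rewrite mulr_sumr -big_split; apply: eq_bigr => i _ /=.
  by rewrite mxE mulrDr [N * _]mulrC.
have -> : \sum_i w 0 i * aff (d i) u =
    \sum_i w 0 i * (u *m (d i).1) 0 0 + \sum_i w 0 i * (d i).2.
  by rewrite -big_split; apply: eq_bigr => i _; rewrite /aff mulrDr.
have -> : \sum_i w 0 i * (1 - w 0 i) = \sum_i w 0 i - dot w w.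
  by rewrite -sumrB; apply: eq_bigr => i _; rewrite mulrBr mulr1.
rewrite /aff; ring.
Qed.

Lemma minmax_program_feasible (U : set 'rV[R]_n)
    (u : 'rV_n) (w : 'rV_r) (v : 'rV_1) :
  @feasible _ _ U minmax_program (row_mx u (row_mx w v)) <->
  [/\ U u, forall t, aff (b t) u <= v 0 0, forall i, 0 <= w 0 i &
      \sum_i w 0 i <= 1].
Proof.
rewrite /feasible /= row_mxKl.
rewrite !mul_row_block !mul_row_col !mulmx0 !add0r addr0.
rewrite mul_mx_scalar scaleN1r.
have sum_w : \sum_i w 0 i * (const_mx 1 : 'cV[R]_r) i 0 = \sum_i w 0 i.
  by apply: eq_bigr => i _; rewrite mxE mulr1.
split=> [[Uu H]|[Uu bv w0 w1]]; last split=> // i.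
  (* The columns of [pA] form three groups: epigraph constraints, signs of the weights, total
     weight. *)
  split=> // [t|i|].
  - have := H (lshift _ (enum_rank t)); rewrite !row_mxEl !mxE big_ord1 mxE mulrN1.
    under eq_bigr do rewrite mxE enum_rankK.
    by rewrite enum_rankK /aff mxE => ?; lra.
  - by have := H (rshift _ (lshift _ i)); rewrite !row_mxEr !row_mxEl !mxE oppr_le0.
  - have := H (rshift _ (rshift _ 0)); rewrite !row_mxEr !mxE.
    by rewrite eqxx addr0 sum_w.
case: (split_ordP i) => {}i ->; rewrite ?row_mxEl ?row_mxEr.
  rewrite !mxE big_ord1 mxE mulrN1; have := bv (enum_val i); rewrite /aff mxE.
  under [X in _ -> X + _ <= _]eq_bigr do rewrite mxE.
  lra.
case: (split_ordP i) => {}i ->; rewrite ?row_mxEl ?row_mxEr !mxE.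
  by rewrite oppr_le0.
by rewrite ord1 eqxx addr0 sum_w.
Qed.

End minmax_program.

(** * Representing a function by a program *)

(** In effect, [phi] is the partial minimum of the program over its auxiliary variables, attained
    above every point of [U]. *)
Definition represents {R : realType} {n : nat} (U : set 'rV[R]_n)
    (phi : 'rV[R]_n -> R) (P : program R n) : Prop :=
  (forall x, @feasible _ _ U P x -> phi (lsubmx x) <= @objective _ _ P x) /\
  forall u, U u -> exists x,
    [/\ @feasible _ _ U P x, lsubmx x = u & @objective _ _ P x = phi u].

(** Here [mn] is min(0, min_i d_i) and [mx] is max_t b_t, known only through bounds and attainment.
    Since [mn <= 0] and the total weight is at most 1, a weighted sum of the d_i is at least [mn];
    each weight lies in [0, 1], so the N-term is nonnegative. *)
Lemma minmax_program_represents {R : realType} {n r : nat} {T : finType}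
    (kappa N : R) (a : affine R n) (d : 'I_r -> affine R n)
    (b : T -> affine R n) (U : set 'rV[R]_n) (mn mx phi : 'rV[R]_n -> R) :
  0 <= N ->
  (forall u, mn u <= 0) -> (forall i u, mn u <= aff (d i) u) ->
  (forall u, mn u = 0 \/ exists i, mn u = aff (d i) u) ->
  (forall t u, aff (b t) u <= mx u) ->
  (forall u, exists t, mx u = aff (b t) u) ->
  (forall u, phi u = kappa * dot u u + aff a u + mn u + mx u) ->
  represents U phi (minmax_program kappa N a d b).
Proof.
move=> N0 mn0 mnd mnE mxb mxbE phiE; split=> [x|u Uu].
  rewrite -[x]hsubmxK -[rsubmx x]hsubmxK; set u := lsubmx x.
  set w := lsubmx _; set v := rsubmx _.
  move=> /minmax_program_feasible[_ bv w0 w1].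
  rewrite minmax_program_objective row_mxKl phiE.
  have mxv : mx u <= v 0 0 by have [t ->] := mxbE u.
  have mnw : mn u <= \sum_i w 0 i * aff (d i) u.
    apply: (@le_trans _ _ (\sum_i w 0 i * mn u)); last first.
      by apply: ler_sum => i _; exact: ler_wpM2l.
    rewrite -mulr_suml -[leLHS]mul1r.
    exact: ler_wnM2r.
  have pen : 0 <= N * \sum_i w 0 i * (1 - w 0 i).
    apply/mulr_ge0/sumr_ge0 => // i _; rewrite mulr_ge0// subr_ge0.
    by apply: le_trans w1; rewrite (bigD1 i)//= lerDl sumr_ge0.
  lra.
have [t tE] := mxbE u.
pose sol w := row_mx u (row_mx w (const_mx (mx u)) : 'rV_(r + 1)).
suff [w [w0 w1 wmn wpen]] : exists w : 'rV[R]_r,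
    [/\ forall i, 0 <= w 0 i, \sum_i w 0 i <= 1,
        \sum_i w 0 i * aff (d i) u = mn u &
        \sum_i w 0 i * (1 - w 0 i) = 0].
  exists (sol w); split; last 1 first.
  - by rewrite minmax_program_objective wmn wpen mulr0 addr0 mxE phiE.
  - by apply/minmax_program_feasible; split=> // t'; rewrite mxE.
  - by rewrite row_mxKl.
(* Zero weights attain the value 0 and the i-th unit vector attains d_i; both kill the N-term. *)
have [mnu|[i mnu]] := mnE u.
  exists 0; split=> [i||| ]; rewrite ?mxE//.
  - by rewrite big1// => i _; rewrite mxE.
  - by rewrite mnu big1// => i _; rewrite mxE mul0r.
  - by rewrite big1// => i _; rewrite mxE mul0r.
exists (delta_mx 0 i); split=> [j|||].
- by rewrite mxE.
- by rewrite (bigD1 i)//= big1 => [|j ji]; rewrite mxE ?eqxx ?addr0// (negPf ji).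
- rewrite (bigD1 i)//= big1 => [|j ji]; rewrite mxE ?eqxx ?addr0 ?mul1r//.
  by rewrite (negPf ji) mul0r.
- rewrite big1// => j _; rewrite mxE eqxx /=.
  by case: (j == i); rewrite ?mul0r// subrr mulr0.
Qed.

(** Feasible sets may be unbounded in the auxiliary variables, so an optimal solution is obtained by
    minimizing [phi t] over the compact [U] and lifting the minimizer. *)
Lemma solved_via_represents {R : realType} {n : nat} {T : finType}
    (U : set 'rV[R]_n) (f : 'rV[R]_n -> R) (phi : T -> 'rV[R]_n -> R)
    (P : T -> program R n) :
  compact U -> U !=set0 -> (forall t, continuous (phi t)) ->
  (forall t, represents U (phi t) (P t)) ->
  (forall t u, f u <= phi t u) -> (forall u, exists t, f u = phi t u) ->
  solved_via U f (fun i : 'I_#|T| => P (enum_val i)).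
Proof.
move=> cU U0 phic Prep fphi phif; split=> [i|x xmin j jmin].
  have [Pge Plift] := Prep (enum_val i).
  have [u /set_mem Uu umin] :=
    compact_EVT_min U0 cU (continuous_subspaceT (phic (enum_val i))).
  have [x [xfeas _ xval]] := Plift u Uu.
  exists x; split=> // y yfeas; rewrite xval.
  by apply: le_trans (Pge y yfeas); apply/umin/mem_set; case: yfeas.
have [xfeas _] := xmin j; split=> [|y Uy]; first by case: xfeas.
apply: (le_trans (fphi (enum_val j) _)).
have [Pge _] := Prep (enum_val j); apply: le_trans (Pge _ xfeas) _.
(* The piece attaining [f y] lifts [y] to a feasible point of value [f y], which bounds the optimal
   value of program [i], hence that of [j]. *)
have [i ->] : exists i : 'I_#|T|, f y = phi (enum_val i) y.
  by have [t ->] := phif y; exists (enum_rank t); rewrite enum_rankK.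
have [x' [x'feas _ <-]] := (Prep (enum_val i)).2 y Uy.
by apply: le_trans (jmin i) _; have [_] := xmin i; exact.
Qed.

(** * Convex, concave and linear instances *)

(** With no weights the quadratic form is kappa |u|^2, so the sign of [kappa] decides. *)
Lemma minmax_program_convex {R : realType} {n : nat} {T : finType}
    (kappa N : R) (a : affine R n) (d : 'I_0 -> affine R n)
    (b : T -> affine R n) :
  0 <= kappa -> is_convex_quadratic (minmax_program kappa N a d b).
Proof.
move=> k0; apply: convex_quadraticP => x.
rewrite -[x]hsubmxK -[rsubmx x]hsubmxK minmax_program_quad.
by rewrite /dot !big_ord0 mulr0 subr0 addr0 mulr_ge0// dotxx_ge0.
Qed.

Lemma minmax_program_concave0 {R : realType} {n : nat} {T : finType}
    (kappa N : R) (a : affine R n) (d : 'I_0 -> affine R n)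
    (b : T -> affine R n) :
  kappa <= 0 -> is_concave_quadratic (minmax_program kappa N a d b).
Proof.
move=> k0; apply: concave_quadraticP => x.
rewrite -[x]hsubmxK -[rsubmx x]hsubmxK minmax_program_quad.
by rewrite /dot !big_ord0 mulr0 subr0 addr0 mulr_le0_ge0// dotxx_ge0.
Qed.

Lemma minmax_program_linear {R : realType} {n : nat} {T : finType}
    (a : affine R n) (d : 'I_0 -> affine R n) (b : T -> affine R n) :
  is_linear_program (minmax_program 0 0 a d b).
Proof.
rewrite /is_linear_program /= oppr0.
by rewrite [\matrix_(i, j) _]thinmx0 row_mx0 !raddf0 !block_mx0.
Qed.

(* Young's inequality on each product [u_j D_ji w_i], with a weight small
   enough for the |u|^2 terms to be absorbed by kappa |u|^2. *)
Lemma minmax_program_concave {R : realType} {n r : nat} {T : finType}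
    (kappa : R) (a : affine R n) (d : 'I_r -> affine R n)
    (b : T -> affine R n) : kappa < 0 ->
  exists2 N, 0 <= N & is_concave_quadratic (minmax_program kappa N a d b).
Proof.
(* Of the r + 1 equal shares of [- kappa], one pays for each of the r weights and one is left over;
   this also covers r = 0. *)
move=> k0; pose e : R := - kappa / r.+1%:R.
have e0 : 0 < e by rewrite divr_gt0// oppr_gt0.
(* The sum of squares of all slopes bounds that of each single d_i, so one [N] serves every
   weight. *)
exists (e^-1 * \sum_i \sum_j ((d i).1 j 0) ^+ 2).
  apply: mulr_ge0; first by rewrite invr_ge0 ltW.
  by apply: sumr_ge0 => i _; apply: sumr_ge0 => j _; exact: sqr_ge0.
apply: concave_quadraticP => x.
rewrite -[x]hsubmxK -[rsubmx x]hsubmxK minmax_program_quad.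
set u := lsubmx x; set w := lsubmx _; clearbody u w.
have young i : w 0 i * (u *m (d i).1) 0 0 <=
    e * dot u u + e^-1 * (w 0 i ^+ 2 * \sum_j ((d i).1 j 0) ^+ 2).
  rewrite mxE !mulr_sumr -big_split; apply: ler_sum => j _ /=.
  set p := w 0 i; set z := u 0 j; set y := (d i).1 j 0.
  rewrite -subr_ge0.
  (* Completing the square uses a quarter of the second term; the rest is slack. *)
  have -> : e * (z * z) + e^-1 * (p ^+ 2 * y ^+ 2) - p * (z * y) =
      e * ((z - p * y / (2 * e)) ^+ 2 + 3 / 4 * (p * y / e) ^+ 2).
    by field; rewrite gt_eqF.
  apply: mulr_ge0; first exact: ltW.
  by apply: addr_ge0; rewrite ?sqr_ge0// mulr_ge0 ?sqr_ge0// divr_ge0.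
have : \sum_i w 0 i * (u *m (d i).1) 0 0 <= r%:R * e * dot u u +
    e^-1 * (\sum_i \sum_j ((d i).1 j 0) ^+ 2) * dot w w.
  apply: (le_trans (ler_sum _ (fun i _ => young i))).
  rewrite big_split sumr_const card_ord /= -[X in X + _]mulr_natl mulrA lerD2l.
  rewrite -mulr_sumr -mulrA ler_pM2l ?invr_gt0//.
  rewrite /dot [leRHS]mulr_sumr; apply: ler_sum => i _.
  rewrite mulrC -expr2 ler_wpM2r ?sqr_ge0//.
  rewrite [leRHS](bigD1 i)//= lerDl sumr_ge0// => k _.
  by rewrite sumr_ge0// => j _; exact: sqr_ge0.
have kE : kappa = - e - r%:R * e.
  by rewrite /e -[r.+1%:R]natr1; field; rewrite natr1 pnatr_eq0.
rewrite [in X in _ -> X]kE; have := mulr_ge0 (ltW e0) (dotxx_ge0 u).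
lra.
Qed.

(** * Continuity and attainment for finite minima and maxima *)

Lemma continuous_quad_aff {R : realType} {n : nat} (kappa : R)
    (a : affine R n) :
  continuous (fun u : 'rV[R]_n => kappa * dot u u + aff a u).
Proof.
have cont_sum (F : 'I_n -> 'rV[R]_n -> R) :
    (forall i, continuous (F i)) -> continuous (fun u => \sum_i F i u).
  move=> Fc; apply: continuous_big => [|i _]; last exact: Fc.
  exact: add_continuous.
have cont_mul (f g : 'rV[R]_n -> R) :
    continuous f -> continuous g -> continuous (fun u => f u * g u).
  by move=> fc gc u; apply: continuousM; [exact: fc|exact: gc].
have cont_coord i : continuous (fun u : 'rV[R]_n => u 0 i).
  exact: coord_continuous.
have cont_cst (k : R) : continuous (fun _ : 'rV[R]_n => k) by exact: cst_continuous.
have cont_add (f g : 'rV[R]_n -> R) :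
    continuous f -> continuous g -> continuous (fun u => f u + g u).
  by move=> fc gc u; apply: continuousD; [exact: fc|exact: gc].
apply/cont_add; first by apply/cont_mul/cont_sum => // i; exact: cont_mul.
apply/cont_add => //; under eq_fun do rewrite mxE.
by apply/cont_sum => i; exact: cont_mul.
Qed.

Lemma bigmin_quad_aff {R : realType} {n : nat} {T : finType} (t0 : T)
    (kappa : R) (a : T -> affine R n) (f : 'rV[R]_n -> R)
    (F := fun t u => kappa * dot u u + aff (a t) u) :
  (forall u, f u = \big[Num.min/F t0 u]_t F t u) ->
  [/\ continuous f, forall t u, f u <= F t u & forall u, exists t, f u = F t u].
Proof.
move=> /funext ->; split=> [|t u|u]; last 2 first.
- exact: bigmin_le.
(* The default value is itself a member of the family, so the fold never leaves it. *)
- elim/big_ind: _ => [|x y [i ->] [j ->]|t _]; [by exists t0| |by exists t].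
  by case: leP => _; [exists i|exists j].
have minc (f1 f2 : 'rV[R]_n -> R) : continuous f1 -> continuous f2 ->
    continuous (fun u => Num.min (f1 u) (f2 u)).
  by move=> f1c f2c u; apply: continuous_min; [exact: f1c|exact: f2c].
elim: (index_enum T) => [|t s IH].
  by under eq_fun do rewrite big_nil; exact: continuous_quad_aff.
under eq_fun do rewrite big_cons.
by apply/minc => //; exact: continuous_quad_aff.
Qed.

Lemma bigmax_quad_aff {R : realType} {n : nat} {T : finType} (t0 : T)
    (kappa : R) (a : T -> affine R n) (f : 'rV[R]_n -> R)
    (F := fun t u => kappa * dot u u + aff (a t) u) :
  (forall u, f u = \big[Num.max/F t0 u]_t F t u) ->
  [/\ continuous f, forall t u, F t u <= f u & forall u, exists t, f u = F t u].
Proof.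
move=> /funext ->; split=> [|t u|u]; last 2 first.
- exact: le_bigmax.
- elim/big_ind: _ => [|x y [i ->] [j ->]|t _]; [by exists t0| |by exists t].
  by case: leP => _; [exists j|exists i].
have maxc (f1 f2 : 'rV[R]_n -> R) : continuous f1 -> continuous f2 ->
    continuous (fun u => Num.max (f1 u) (f2 u)).
  by move=> f1c f2c u; apply: continuous_max; [exact: f1c|exact: f2c].
elim: (index_enum T) => [|t s IH].
  by under eq_fun do rewrite big_nil; exact: continuous_quad_aff.
under eq_fun do rewrite big_cons.
by apply/maxc => //; exact: continuous_quad_aff.
Qed.

(* u |-> c + g.(s - q) + sigma |s - q|^2 - sigma |u|^2, where s = (zt, u). *)
Definition model_affine {R : realType} {nZ nU : nat} (sigma : R)
    (zt : 'rV[R]_nZ) (q : 'rV[R]_(nZ + nU)) (c : R) (g : 'rV[R]_(nZ + nU)) :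
    affine R nU :=
  let s0 := row_mx zt 0 - q in
  ((rsubmx g + (2 * sigma) *: rsubmx s0)^T,
   c + dot g s0 + sigma * dot s0 s0).

(** Expand around [s0], using (zt, u) - q = s0 + (0, u). The coefficient of |u|^2 does not depend on
    [q], which lets minima and maxima act on affine parts alone. *)
Lemma model_affineE {R : realType} {nZ nU : nat} (sigma : R)
    (zt : 'rV[R]_nZ) (q : 'rV[R]_(nZ + nU)) (c : R) (g : 'rV[R]_(nZ + nU))
    (u : 'rV[R]_nU) :
  c + dot g (row_mx zt u - q) + sigma * enorm (row_mx zt u - q) ^+ 2 =
  sigma * dot u u + aff (model_affine sigma zt q c g) u.
Proof.
rewrite enorm_sqr /aff /= -dot_mulmx.
have -> : row_mx zt u - q = (row_mx zt 0 - q) + row_mx 0 u.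
  by rewrite addrAC add_row_mx addr0 add0r.
set s0 := row_mx zt 0 - q.
have dotC m (x y : 'rV[R]_m) : dot x y = dot y x.
  by apply: eq_bigr => i _; rewrite mulrC.
have dotDr m (x y z : 'rV[R]_m) : dot x (y + z) = dot x y + dot x z.
  by rewrite /dot -big_split; apply: eq_bigr => i _; rewrite mxE mulrDr.
have dotZr m k (x y : 'rV[R]_m) : dot x (k *: y) = k * dot x y.
  by rewrite /dot mulr_sumr; apply: eq_bigr => i _; rewrite mxE mulrCA.
have dot_row0 x : dot x (row_mx 0 u) = dot u (rsubmx x).
  rewrite /dot big_split_ord big1 => [|i _]; last by rewrite row_mxEl mxE mulr0.
  by rewrite /= add0r; apply: eq_bigr => i _; rewrite row_mxEr mxE mulrC.
clearbody s0; rewrite !dotDr dotZr !dot_row0 (dotC _ (s0 + _) s0) dotDr dot_row0.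
rewrite raddfD /= row_mxKr dotDr; ring.
Qed.

(** Separates the quantifiers: [P] is fixed from the data, while [U] and [C] come later and reach
    [phi] only through bounds, attainment and continuity of [cplus] and [cminus]. *)
Lemma solvable_by_represents {R : realType} {nZ nU t : nat} {t0 : (0 < t)%N}
    {L alpha beta : R} {zt : 'rV[R]_nZ} {q : 'I_t -> 'rV[R]_(nZ + nU)}
    {c : 'I_t -> R} {g : 'I_t -> 'rV[R]_(nZ + nU)}
    {kind : program R nU -> Prop} {maxaux K : nat} {T : finType}
    (P : T -> program R nU)
    (fplus := fun i u => L / 2 * dot u u +
       aff (model_affine (L / 2) zt (q i) (c i) (g i)) u)
    (fminus := fun i u => - (L / 2) * dot u u +
       aff (model_affine (- (L / 2)) zt (q i) (c i) (g i)) u) :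
  (0 < #|T| <= K)%N -> (forall x, kind (P x)) ->
  (forall x, (naux (P x) <= maxaux)%N) ->
  (forall cplus cminus : 'rV[R]_nU -> R,
     continuous cplus -> continuous cminus ->
     (forall i u, cplus u <= fplus i u) ->
     (forall u, exists i, cplus u = fplus i u) ->
     (forall i u, fminus i u <= cminus u) ->
     (forall u, exists i, cminus u = fminus i u) ->
     exists phi : T -> 'rV[R]_nU -> R,
       [/\ forall x, continuous (phi x),
           forall U x, represents U (phi x) (P x),
           forall x u, alpha * cplus u + beta * cminus u <= phi x u &
           forall u, exists x, alpha * cplus u + beta * cminus u = phi x u]) ->
  solvable_by t0 L alpha beta zt q c g kind maxaux K.
Proof.
move=> TK kindP auxP phiP; exists #|T|, (fun i => P (enum_val i)).
split=> [//|i|i|Z U C st _ qZU Cq gq]; [exact: kindP|exact: auxP|].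
pose cplus u := Cplus t0 L C q (row_mx zt u).
pose cminus u := Cminus t0 L C q (row_mx zt u).
have [pc ple pex] : [/\ continuous cplus, forall i u, cplus u <= fplus i u &
    forall u, exists i, cplus u = fplus i u].
  apply: (bigmin_quad_aff (Ordinal t0)) => u; rewrite /cplus /Cplus /lin_approx.
  rewrite Cq gq model_affineE.
  by apply: eq_bigr => i _; rewrite Cq gq model_affineE.
have [mc mle mex] : [/\ continuous cminus, forall i u, fminus i u <= cminus u &
    forall u, exists i, cminus u = fminus i u].
  apply: (bigmax_quad_aff (Ordinal t0)) => u.
  rewrite /cminus /Cminus /lin_approx Cq gq -mulNr model_affineE.
  by apply: eq_bigr => i _; rewrite Cq gq -mulNr model_affineE.
have [phi [phic Prep mphi mphiE]] := phiP _ _ pc mc ple pex mle mex.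
apply: (solved_via_represents _ _ phi) => //.
  exact: standing_compactU st.
(* The control part of the first data point shows that [U] is nonempty. *)
by exists (rsubmx (q (Ordinal t0))); have [] := qZU (Ordinal t0).
Qed.

Lemma continuous_lincomb {R : realType} {T : topologicalType} (k l : R)
    (f h : T -> R) :
  continuous f -> continuous h -> continuous (fun x => k * f x + l * h x).
Proof.
move=> fc hc x; apply: (@continuousD _ R^o _ (fun x => k * f x)).
  by apply: continuousM; [exact: cst_continuous|exact: fc].
by apply: continuousM; [exact: cst_continuous|exact: hc].
Qed.

(** * The five sign cases *)

Theorem corollary1 (R : realType) (nZ nU t : nat) (t0 : (0 < t)%N)
    (L alpha beta : R) (L0 : 0 < L)
    (zt : 'rV[R]_nZ) (q : 'I_t -> 'rV[R]_(nZ + nU))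
    (c : 'I_t -> R) (g : 'I_t -> 'rV[R]_(nZ + nU)) :
  let solvable := solvable_by t0 L alpha beta zt q c g in
  [/\ 0 < alpha -> beta <= 0 -> solvable (@is_convex_quadratic R nU) 1%N (t ^ 2)%N,
      beta < alpha -> 0 <= beta -> solvable (@is_convex_quadratic R nU) 1%N t,
      alpha = beta -> solvable (@is_linear_program R nU) 1%N t,
      alpha < beta -> 0 <= alpha ->
        solvable (@is_concave_quadratic R nU) (if alpha == 0 then 1%N else t) 1%N &
      0 < beta -> alpha <= 0 -> solvable (@is_concave_quadratic R nU) 1%N t].
Proof.
move=> solvable.
pose ap i := model_affine (L / 2) zt (q i) (c i) (g i).
pose am i := model_affine (- (L / 2)) zt (q i) (c i) (g i).
pose fp i (u : 'rV[R]_nU) := L / 2 * dot u u + aff (ap i) u.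
pose fm i (u : 'rV[R]_nU) := - (L / 2) * dot u u + aff (am i) u.
have fpc i : continuous (fp i) by exact: continuous_quad_aff.
have fmc i : continuous (fm i) by exact: continuous_quad_aff.
have L20 : 0 < L / 2 by exact: divr_gt0.
pose kappa := (alpha - beta) * (L / 2).
have kappa_ge0 : beta <= alpha -> 0 <= kappa.
  by move=> ba; rewrite mulr_ge0 ?subr_ge0// ltW.
have kappa_le0 : alpha <= beta -> kappa <= 0.
  by move=> ab; rewrite mulr_le0_ge0 ?subr_le0// ltW.
pose d0 (_ : 'I_0) : affine R nU := 0.
(* Both coefficients nonnegative: one program per piece of the minimum, the maximum going to the
   epigraph. *)
pose Pplus i := minmax_program kappa 0 (alpha *: ap i) d0 (fun j => beta *: am j).
have Pplus_solves kind : 0 <= alpha -> 0 <= beta -> (forall i, kind (Pplus i)) ->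
    solvable kind 1%N t.
  move=> a0 b0 kindP; apply: (solvable_by_represents Pplus) => //.
    by rewrite card_ord t0 /=.
  move=> cp cm cpc cmc cple cpex cmle cmex.
  exists (fun i u => alpha * fp i u + beta * cm u); split=> [i|U i|i u|u].
  - exact: continuous_lincomb.
  (* Adding L/2 |u|^2 to [cm] leaves a maximum of affine functions; [kappa] absorbs the
     correction. *)
  - apply: (minmax_program_represents _ _ _ _ _ _ (fun=> 0)
      (fun u => beta * (cm u + L / 2 * dot u u))) => //.
    + by case.
    + by move=> u; left.
    + by move=> j u; rewrite affZ ler_wpM2l//; have := cmle j u; lra.
    + by move=> u; have [j cmE] := cmex u; exists j; rewrite affZ cmE; ring.
    + by move=> u; rewrite affZ /fp /kappa; ring.
  - by rewrite lerD2r ler_wpM2l// cple.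
  - by have [i cpE] := cpex u; exists i; rewrite cpE.
(* Both coefficients nonpositive: the roles swap, as [beta] turns the maximum into a minimum and
   [alpha] the minimum into a maximum. *)
pose Pminus j :=
  minmax_program kappa 0 (beta *: am j) d0 (fun i => alpha *: ap i).
have Pminus_solves kind : alpha <= 0 -> beta <= 0 ->
    (forall j, kind (Pminus j)) -> solvable kind 1%N t.
  move=> a0 b0 kindP; apply: (solvable_by_represents Pminus) => //.
    by rewrite card_ord t0 /=.
  move=> cp cm cpc cmc cple cpex cmle cmex.
  exists (fun j u => alpha * cp u + beta * fm j u); split=> [j|U j|j u|u].
  - exact: continuous_lincomb.
  - apply: (minmax_program_represents _ _ _ _ _ _ (fun=> 0)
      (fun u => alpha * (cp u - L / 2 * dot u u))) => //.
    + by case.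
    + by move=> u; left.
    + by move=> i u; rewrite affZ ler_wnM2l//; have := cple i u; lra.
    + by move=> u; have [i cpE] := cpex u; exists i; rewrite affZ cpE; ring.
    + by move=> u; rewrite affZ /fm /kappa; ring.
  - by rewrite lerD2l ler_wnM2l// cmle.
  - by have [j cmE] := cmex u; exists j; rewrite cmE.
(* Both scaled terms are maxima; their sum is a maximum over pairs, so one epigraph variable with
   t^2 constraints suffices. *)
pose Pmax := minmax_program kappa 0 0 d0
  (fun ij : 'I_t * 'I_t => alpha *: ap ij.1 + beta *: am ij.2).
have Pmax_solves K : alpha <= 0 -> 0 < beta -> (0 < K)%N ->
    solvable (@is_concave_quadratic R nU) 1%N K.
  move=> a0 b0 K0; apply: (solvable_by_represents (fun _ : unit => Pmax)) => //.
  - by rewrite card_unit.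
  - by move=> _; apply/minmax_program_concave0/kappa_le0; lra.
  move=> cp cm cpc cmc cple cpex cmle cmex.
  exists (fun _ u => alpha * cp u + beta * cm u); split=> [_|U _|//|u].
  - exact: continuous_lincomb.
  - apply: (minmax_program_represents _ _ _ _ _ _ (fun=> 0)
      (fun u => alpha * (cp u - L / 2 * dot u u) +
                beta * (cm u + L / 2 * dot u u))) => //.
    + by case.
    + by move=> u; left.
    + move=> [i j] u; rewrite affD !affZ /= lerD//.
        by rewrite ler_wnM2l//; have := cple i u; lra.
      by rewrite ler_pM2l//; have := cmle j u; lra.
    + move=> u; have [i cpE] := cpex u; have [j cmE] := cmex u; exists (i, j).
      by rewrite affD !affZ /= cpE cmE; ring.
    + by move=> u; rewrite aff0 /kappa; ring.
  - by exists tt.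
split.
- move=> a0 b0.
  (* Both scaled terms are minima: one program per pair of pieces, with a trivial epigraph
     [0 <= v]. *)
  pose P (ij : 'I_t * 'I_t) :=
    minmax_program kappa 0 (alpha *: ap ij.1 + beta *: am ij.2) d0
      (fun _ : unit => 0).
  apply: (solvable_by_represents P) => //.
  + by rewrite card_prod card_ord mulnn expn_gt0 t0 /=.
  + by move=> ij; apply/minmax_program_convex/kappa_ge0; lra.
  move=> cp cm cpc cmc cple cpex cmle cmex.
  exists (fun ij u => alpha * fp ij.1 u + beta * fm ij.2 u).
  split=> [ij|U ij|[i j] u|u].
  + exact: continuous_lincomb.
  + apply: (minmax_program_represents _ _ _ _ _ _ (fun=> 0) (fun=> 0)) => //.
    * by case.
    * by move=> u; left.
    * by move=> _ u; rewrite aff0.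
    * by move=> u; exists tt; rewrite aff0.
    * by move=> u; rewrite affD !affZ /fp /fm /kappa; ring.
  + by rewrite lerD ?(ler_wnM2l b0 (cmle j u)) ?(ler_wpM2l (ltW a0) (cple i u)).
  + have [i cpE] := cpex u; have [j cmE] := cmex u; exists (i, j).
    by rewrite cpE cmE.
- move=> ba b0; apply: Pplus_solves => //; first by lra.
  by move=> i; apply/minmax_program_convex/kappa_ge0; lra.
- move=> ab; have k0 : kappa = 0 by rewrite /kappa ab subrr mul0r.
  have [a0|a0] := leP 0 alpha.
    apply: Pplus_solves; rewrite -?ab// => i.
    by rewrite /Pplus k0; exact: minmax_program_linear.
  apply: Pminus_solves; rewrite -?ab ?ltW// => i.
  by rewrite /Pminus k0; exact: minmax_program_linear.
- move=> ab a0; case: eqVneq => [a00|a_neq0].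
    by apply: Pmax_solves => //; rewrite -?a00.
  have {a_neq0}a0 : 0 < alpha by rewrite lt_def a_neq0.
  have b0 : 0 < beta by exact: lt_trans ab.
  have k0 : kappa < 0 by rewrite nmulr_rlt0 ?subr_lt0.
  (* Piece [i0] is the base and the others enter as differences: t - 1 weights and the epigraph
     variable make t auxiliary variables. *)
  pose i0 := Ordinal t0.
  pose d (i : 'I_t.-1) := alpha *: (ap (lift i0 i) - ap i0).
  have [N N0 Pconcave] := minmax_program_concave kappa (alpha *: ap i0) d
    (fun j => beta *: am j) k0.
  apply: (solvable_by_represents (fun _ : unit => _) _ (fun=> Pconcave)) => //.
  + by rewrite card_unit.
  + by rewrite /= addn1 prednK.
  move=> cp cm cpc cmc cple cpex cmle cmex.
  exists (fun _ u => alpha * cp u + beta * cm u); split=> [_|U _|//|u].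
  + exact: continuous_lincomb.
  + apply: (minmax_program_represents _ _ _ _ _ _
      (fun u => alpha * (cp u - fp i0 u))
      (fun u => beta * (cm u + L / 2 * dot u u))) => //.
    * by move=> u; rewrite pmulr_rle0// subr_le0 cple.
    * move=> i u; rewrite affZ affB ler_pM2l//.
      by have := cple (lift i0 i) u; rewrite /fp; lra.
    * move=> u; have [i ->] := cpex u.
      have [j ->|->] := unliftP i0 i; last by left; rewrite subrr mulr0.
      by right; exists j; rewrite affZ affB /fp; ring.
    * by move=> j u; rewrite affZ ler_pM2l//; have := cmle j u; lra.
    * by move=> u; have [j cmE] := cmex u; exists j; rewrite affZ cmE; ring.
    * by move=> u; rewrite affZ /fp /kappa; ring.
  + by exists tt.
- by move=> b0 a0; exact: Pmax_solves.
Qed.
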